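(* Let $K$ be an oriented virtual knotoid and $D$ a diagram of $K$. Then: (1) $\mathbf{P}_{r(D)}(x,y)= -\mathbf{P}_D(x^{-1},y^{-1})$. If $K$ is invertible, then $\mathbf{P}_{D}(x,y)=-\mathbf{P}_{D}(x^{-1},y^{-1})$. (2) $\mathbf{P}_{m(D)}(x,y)= \mathbf{P}_{D}(x^{-1},y^{-1})$. If $K$ is amphichiral, then $\mathbf{P}_D(x,y)= \mathbf{P}_D(x^{-1},y^{-1})$. (3) If $K$ is both invertible and amphichiral, then $\mathbf{P}_D (x,y)=0$.
   Context: **Virtual knotoids.** A knotoid diagram in $S^2$ is a generic immersion of $[0,1]$ into the oriented sphere $S^2$ with finitely many transverse double points, each endowed with over/under information (classical crossings). The images of $0$ and $1$ are the tail and the head; they are distinct from each other and from all crossings. The diagram is oriented from tail to head. A virtual knotoid diagram may also have virtual crossings (double points marked by a small circle, with no over/under information). A virtual knotoid is an equivalence class of virtual knotoid diagrams under isotopy and the generalized Reidemeister moves: the classical moves $\Omega_1,\Omega_2,\Omega_3$ (performed away from the endpoints); their analogues $\Omega_1^v,\Omega_2^v,\Omega_3^v$ with all crossings virtual; the mixed move $\Omega_3^m$ (a strand having virtual crossings with both strands of a classical crossing is moved across that classical crossing); and the move $\Omega_v$ (an endpoint is moved across a strand, creating or removing a virtual crossing). Moving an endpoint over or under a strand so as to create or remove a classical crossing is forbidden. **Sign.** Draw a classical crossing $c$ with both strands directed upward. Then $\operatorname{sgn}(c)=1$ if the over-strand goes from bottom left to top right, and $\operatorname{sgn}(c)=-1$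 if the over-strand goes from bottom right to top left. $C(D)$ is the set of classical crossings of $D$. **Labels and weight.** Arcs are the segments of $D$ between consecutive crossings (or endpoints). Integer labels $\ell$ are assigned to arcs starting from the tail (initial label $0$): at a classical crossing drawn with both strands upward, the label increases by $1$ along the strand going from bottom right to top left and decreases by $1$ along the strand going from bottom left to top right (regardless of over/under); labels do not change at virtual crossings. If at $c$ the incoming arcs are $\alpha$ (bottom left) and $\beta$ (bottom right), the weight is $W_D(c)=\operatorname{sgn}(c)\big(\ell(\alpha)-(\ell(\beta)+1)\big)$. **Smoothing, parity, intersection index.** The orientation-preserving smoothing at $c$ (joining the bottom-left incoming arc to the top-left outgoing arc and the bottom-right incoming arc to the top-right outgoing arc) gives an ordered two-component diagram $D_1\cup D_2$: if $\operatorname{sgn}(c)=1$, $D_1$ is the component containing the left smoothed strand and $D_2$ the one containing the right smoothed strand; if $\operatorname{sgn}(c)=-1$, $D_1$ contains the right one and $D_2$ the left one. $I(c)$ is the number of classical crossings between $D_1$ and $D_2$; $c$ is even if $I(c)$ is even and odd otherwise. $E(D)$ and $O(D)$ are the sets of even and odd crossings of $D$. For a classical crossing $e$ between $D_1$ and $D_2$ put $\operatorname{ind}(e)=\operatorname{sgn}(e)$ if $D_1$ is the over-strand at $e$, and $\operatorname{ind}(e)=-\operatorname{sgn}(e)$ if $D_2$ is the over-strand at $e$. The intersection index is $i(c)=\sum_{e\in D_1\cap D_2}\operatorname{ind}(e)$, the sum over classical crossings between $D_1$ and $D_2$. **The polynomial.** For a diagram $D$ of a virtual knotoid, $$\mathbf{P}_D(x,y)=\sum_{c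 \in E(D)} \operatorname{sgn}(c)\, i(c)\, x^{W_D(c)} + \sum_{c \in O(D)} \operatorname{sgn}(c)\, i(c)\, y^{W_D(c)}\in\mathbb Z[x^{\pm1},y^{\pm1}],$$ which depends only on the virtual knotoid represented by $D$. **Inversion and mirror image.** $r(D)$ is the diagram $D$ with its orientation reversed; $m(D)$ is the diagram obtained from $D$ by switching the over- and under-strands at every classical crossing. Let $r(K)$ and $m(K)$ be the virtual knotoids represented by $r(D)$ and $m(D)$. $K$ is invertible if $K$ is equivalent to $r(K)$, and amphichiral if $K$ is equivalent to $m(K)$. *)

(* Defs.v *)
From HB Require Import structures.
From mathcomp Require Import all_boot all_order all_algebra.
From mathcomp Require Import finmap monalg.
From Stdlib Require Import Relations.

Set Implicit Arguments.
Unset Strict Implicit.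
Unset Printing Implicit Defensive.

Import GRing.Theory.
Local Open Scope ring_scope.

(* A virtual knotoid diagram is connected, so up to isotopy of the oriented   *)
(* sphere it is determined by its underlying plane graph (a combinatorial     *)
(* map of genus 0) with its crossing decorations. We traverse the diagram     *)
(* from tail to head and record each passage through a crossing: the name of  *)
(* the crossing, whether, in the picture with both strands directed upward,   *)
(* the passage goes from bottom left to top right (otherwise it goes from     *)
(* bottom right to top left), and whether it is over, under or virtual. This  *)
(* word determines the cyclic order of the arcs around every crossing, hence  *)
(* the combinatorial map.                                                     *)

Inductive level := Over | Under | Virtual.

Definition level_code (l : level) : option bool :=
  match l with Over => Some true | Under => Some false | Virtual => None end.
Definition level_decode (o : option bool) : level :=
  match o with Some true => Over | Some false => Under | None => Virtual end.
Lemma level_codeK : cancel level_code level_decode.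
Proof. by case. Qed.
HB.instance Definition _ := Equality.copy level (can_type level_codeK).

Definition opposite_level (l : level) : level :=
  match l with Over => Under | Under => Over | Virtual => Virtual end.

Record passage := Passage {
  crossing : nat;
  from_left : bool;
  level_of : level
}.

Definition passage_code (u : passage) := (crossing u, from_left u, level_of u).
Definition passage_decode (t : nat * bool * level) :=
  Passage t.1.1 t.1.2 t.2.
Lemma passage_codeK : cancel passage_code passage_decode.
Proof. by case. Qed.
HB.instance Definition _ := Equality.copy passage (can_type passage_codeK).

Definition classical (u : passage) : bool := level_of u != Virtual.

(* The passage of the other strand through the same crossing. *)
Definition mate (u : passage) : passage :=
  Passage (crossing u) (~~ from_left u) (opposite_level (level_of u)).

Definition well_paired (w : seq passage) : bool :=
  [&& uniq w,
      all (fun u => mate u \in w) w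
    & all (fun u => all (fun v =>
        (crossing u == crossing v) ==> ((v == u) || (v == mate u))) w) w].

(* For 0 <= k <= size w, the arc k precedes the k-th passage (counted from 0) *)
(* and follows the previous one; arc 0 starts at the tail and arc (size w)    *)
(* ends at the head. A dart is an arc with a direction of travel, true being  *)
(* tail to head. face_step follows a dart to its end, where it takes the      *)
(* sharpest left turn (a U-turn at an end of the diagram), so that its orbits *)
(* are the faces of the combinatorial map. A left turn at a crossing leads to *)
(* the other strand; it then follows the orientation of that strand exactly   *)
(* when one arrives along the strand from bottom left to top right forwards,  *)
(* or along the strand from bottom right to top left backwards.               *)
Definition dart (w : seq passage) : finType := ('I_(size w).+1 * bool)%type.

Definition left_turn (w : seq passage) (u : passage) (forward : bool) : dart w :=
  let k := index (mate u) w in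
  if from_left u == forward then (inord k.+1, true) else (inord k, false).

Definition face_step (w : seq passage) (d : dart w) : dart w :=
  let: (k, forward) := d in
  if forward then
    match drop k w with
    | u :: _ => left_turn w u true
    | [::] => (k, false)
    end
  else
    match rev (take k w) with
    | u :: _ => left_turn w u false
    | [::] => (k, true)
    end.

Arguments face_step : simpl never.

(* Euler's formula: with n crossings (size w = 2n) there are n + 2 vertices   *)
(* and 2n + 1 edges, so the genus is 0 exactly when there are n + 1 faces.    *)
Definition spherical (w : seq passage) : bool :=
  fcard (@face_step w) predT == (size w)./2.+1.

Record diagram := Diagram {
  word :> seq passage;
  word_paired : well_paired word;
  word_spherical : spherical word
}.

(* The third Reidemeister moves act on three strands, each given here by its  *)
(* two successive passages.                                                   *)
Definition first_passages (s : seq (passage * passage)) := [seq p.1 | p <- s].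
Definition strand_passages (s : seq (passage * passage)) :=
  [seq p.1 | p <- s] ++ [seq p.2 | p <- s].

Definition pairwise_crossing (s : seq (passage * passage)) : bool :=
  all (fun u => mate u \in strand_passages s) (strand_passages s)
  && all (fun p => mate p.1 != p.2) s.

(* For a passage u of a strand p, the segment of the other strand at u that   *)
(* joins its two crossings leaves to the left of p iff (first passage of that *)
(* strand at mate u) = from_left u. The three segments bound a triangular     *)
(* face iff, for each strand p, both of these lie on the same side of p.      *)
Definition on_left (s : seq (passage * passage)) (u : passage) : bool :=
  (mate u \in first_passages s) == from_left u.

Definition triangle (s : seq (passage * passage)) : bool :=
  pairwise_crossing s && all (fun p => on_left s p.1 == on_left s p.2) s.

Definition strand_at (l : level) (p : passage * passage) : bool :=
  (level_of p.1 == l) && (level_of p.2 == l).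

(* Classical move: all crossings are classical and one strand lies above the  *)
(* two others. Virtual move: all crossings are virtual. Mixed move: a strand  *)
(* crosses virtually both strands of a classical crossing. In particular, no  *)
(* move takes an over- or understrand across a virtual crossing.              *)
Definition omega3_classical (s : seq (passage * passage)) : bool :=
  all classical (strand_passages s) && has (strand_at Over) s.
Definition omega3_virtual (s : seq (passage * passage)) : bool :=
  all (strand_at Virtual) s.
Definition omega3_mixed (s : seq (passage * passage)) : bool :=
  has (strand_at Virtual) s && has classical (strand_passages s).

(* Moves between words; they are only used below when both words are          *)
(* spherical diagrams. Since the inserted or permuted passages determine the  *)
(* combinatorial map locally, the monogon, bigon or triangle of the move is   *)
(* then a face of the diagram. Moves 1 and 2 are stated for classical and     *)
(* virtual crossings at the same time, according to the level of u; in move   *)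
(* 2, u and v may be on either of the two strands, as mate is an involution.  *)
Inductive move : seq passage -> seq passage -> Prop :=
| Rename (f : nat -> nat) (w : seq passage) of injective f :
    move w [seq Passage (f (crossing u)) (from_left u) (level_of u) | u <- w]
| Omega1 (w0 w1 : seq passage) (u : passage) :
    move (w0 ++ w1) (w0 ++ [:: u; mate u] ++ w1)
| Omega2 (w0 w1 w2 t : seq passage) (u v : passage) of
    level_of u = level_of v & from_left u = ~~ from_left v &
    t = [:: mate u; mate v] \/ t = [:: mate v; mate u] :
    move (w0 ++ w1 ++ w2) (w0 ++ [:: u; v] ++ w1 ++ t ++ w2)
| Omega3 (w0 w1 w2 w3 : seq passage) (p q r : passage * passage) of
    triangle [:: p; q; r] &
    [|| omega3_classical [:: p; q; r], omega3_virtual [:: p; q; r]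
      | omega3_mixed [:: p; q; r]] :
    move (w0 ++ [:: p.1; p.2] ++ w1 ++ [:: q.1; q.2] ++ w2
             ++ [:: r.1; r.2] ++ w3)
         (w0 ++ [:: p.2; p.1] ++ w1 ++ [:: q.2; q.1] ++ w2
             ++ [:: r.2; r.1] ++ w3)
| OmegaV_tail (w0 w1 : seq passage) (u : passage) of level_of u = Virtual :
    move (w0 ++ w1) (u :: w0 ++ mate u :: w1)
| OmegaV_head (w0 w1 : seq passage) (u : passage) of level_of u = Virtual :
    move (w0 ++ w1) (w0 ++ u :: w1 ++ [:: mate u]).

Definition equivalent : diagram -> diagram -> Prop :=
  clos_refl_sym_trans diagram (fun D D' => move D D').

Record virtual_knotoid := VirtualKnotoid {
  has_diagram :> diagram -> Prop;
  knotoid_class : exists D, forall D', has_diagram D' <-> equivalent D D'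
}.

(* Reversing the orientation turns the upward picture of a crossing by a half *)
(* turn, so the strand from bottom left to top right remains so.              *)
Definition reverse_word (w : seq passage) : seq passage := rev w.

Definition switch (u : passage) : passage :=
  Passage (crossing u) (from_left u) (opposite_level (level_of u)).
Definition switch_word (w : seq passage) : seq passage := map switch w.

Lemma mateK : involutive mate.
Proof. by case=> c b [] /=; rewrite /mate /= negbK. Qed.

Lemma switchK : involutive switch.
Proof. by case=> c b []. Qed.

Lemma mate_switch u : mate (switch u) = switch (mate u).
Proof. by case: u. Qed.

Lemma well_paired_reverse w : well_paired (reverse_word w) = well_paired w.
Proof.
rewrite /well_paired /reverse_word rev_uniq !all_rev; congr [&& _, _ & _].
  by apply: eq_all => u; rewrite mem_rev.
by apply: eq_all => u; rewrite all_rev.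
Qed.

Lemma well_paired_switch w : well_paired (switch_word w) = well_paired w.
Proof.
have injS := inv_inj switchK.
rewrite /well_paired /switch_word (map_inj_uniq injS) !all_map.
congr [&& _, _ & _].
  by apply: eq_all => u /=; rewrite mate_switch (mem_map injS).
apply: eq_all => u /=; rewrite all_map; apply: eq_all => v /=.
by rewrite mate_switch !(inj_eq injS).
Qed.

Lemma fcard_conj (T T' : finType) (f : T -> T) (f' : T' -> T') (h : T' -> T) :
  injective f -> injective f' -> bijective h ->
  (forall x, h (f' x) = f (h x)) -> fcard f predT = fcard f' predT.
Proof.
move=> injf injf' [g hK gK] hf.
have hi n x : h (iter n f' x) = iter n f (h x).
  by elim: n => //= n IH; rewrite hf IH.
rewrite (adjunction_n_comp h (fconnect_sym injf) (fconnect_sym injf')) //.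
split=> [x _|x y _]; first by exists (g x); rewrite gK.
apply/idP/idP => [/iter_findex <-|/iter_findex]; first by rewrite hi fconnect_iter.
by rewrite -hi => /(can_inj hK) <-; rewrite fconnect_iter.
Qed.

Section FaceStep.
Variables (w : seq passage) (u0 : passage).
Hypothesis wP : well_paired w.

Let wU : uniq w. Proof. by case/and3P: wP. Qed.
Let wM u : u \in w -> mate u \in w.
Proof. by case/and3P: wP => _ /allP H _; apply: H. Qed.

Definition mate_index k := index (mate (nth u0 w k)) w.

Lemma mate_index_lt k : (k < size w)%N -> (mate_index k < size w)%N.
Proof. by move=> lt_k; rewrite index_mem wM ?mem_nth. Qed.

Lemma nth_mate_index k : (k < size w)%N ->
  nth u0 w (mate_index k) = mate (nth u0 w k).
Proof. by move=> lt_k; rewrite nth_index // wM ?mem_nth. Qed.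

Lemma mate_indexK k : (k < size w)%N -> mate_index (mate_index k) = k.
Proof.
by move=> lt_k; rewrite /mate_index nth_mate_index // mateK index_uniq.
Qed.

Lemma face_stepT (k : 'I_(size w).+1) : (k < size w)%N ->
  face_step (k, true) = if from_left (nth u0 w k)
    then (inord (mate_index k).+1, true) else (inord (mate_index k), false).
Proof.
by move=> lt_k; rewrite /face_step (drop_nth u0) // /left_turn; case: from_left.
Qed.

Lemma face_stepF (k : 'I_(size w).+1) : (0 < k)%N ->
  face_step (k, false) = if from_left (nth u0 w k.-1)
    then (inord (mate_index k.-1), false) else (inord (mate_index k.-1).+1, true).
Proof.
case: k => -[//|k] /= lt_k _; rewrite /face_step /= (take_nth u0) // rev_rcons.
by rewrite /left_turn /mate_index; case: from_left.
Qed.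

Lemma face_stepTn (k : 'I_(size w).+1) :
  k = size w :> nat -> face_step (k, true) = (k, false).
Proof. by move=> def_k; rewrite /face_step def_k drop_size. Qed.

Lemma face_stepF0 (k : 'I_(size w).+1) :
  k = 0%N :> nat -> face_step (k, false) = (k, true).
Proof. by move=> def_k; rewrite /face_step def_k take0. Qed.

Definition face_back (d : dart w) : dart w :=
  let: (k, forward) := d in
  if forward then
    if k == 0%N :> nat then (k, false) else
    if from_left (nth u0 w k.-1) then (inord (mate_index k.-1).+1, false)
    else (inord (mate_index k.-1), true)
  else
    if k == size w :> nat then (k, true) else
    if from_left (nth u0 w k) then (inord (mate_index k), true)
    else (inord (mate_index k).+1, false).

Lemma face_stepK : cancel (@face_step w) face_back.
Proof.
case=> k [].
  have [lt_k|ge_k] := ltnP k (size w); last first.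
    have def_k : k = size w :> nat by apply/eqP; rewrite eqn_leq ge_k -ltnS ltn_ord.
    by rewrite face_stepTn //= def_k eqxx.
  have lt_m := mate_index_lt lt_k.
  rewrite face_stepT //; case E: from_left => /=; rewrite inordK ?ltnS // 1?ltnW //=.
    by rewrite nth_mate_index //= E mate_indexK // inord_val.
  by rewrite ltn_eqF // nth_mate_index //= E mate_indexK // inord_val.
have [def_k|k_gt0] := posnP k; first by rewrite face_stepF0 //= def_k.
have lt_k : (k.-1 < size w)%N by rewrite -ltnS prednK.
have lt_m := mate_index_lt lt_k.
rewrite face_stepF //; case E: from_left => /=; rewrite inordK ?ltnS // 1?ltnW //=.
  by rewrite ltn_eqF // nth_mate_index //= E mate_indexK // prednK // inord_val.
by rewrite nth_mate_index //= E mate_indexK // prednK // inord_val.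
Qed.

Lemma face_step_inj : injective (@face_step w).
Proof. exact: can_inj face_stepK. Qed.

End FaceStep.

Lemma index_rev (w : seq passage) u : uniq w -> u \in w ->
  index u (rev w) = (size w - (index u w).+1)%N.
Proof.
move=> wU uw; have lt_i : (index u w < size w)%N by rewrite index_mem.
have lt_j : (size w - (index u w).+1 < size w)%N by rewrite ltn_subrL; case: (w) uw.
have E : nth u (rev w) (size w - (index u w).+1) = u.
  by rewrite nth_rev // subnSK // subKn ?nth_index // ltnW.
have := @index_uniq _ u (size w - (index u w).+1) (rev w).
by rewrite E size_rev rev_uniq => ->.
Qed.

Lemma spherical_reverse w : well_paired w ->
  spherical (reverse_word w) = spherical w.
Proof.
move=> wP; have wP' : well_paired (reverse_word w) by rewrite well_paired_reverse.
have sz : size (reverse_word w) = size w by rewrite size_rev.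
rewrite /spherical sz; congr (_ == _).
pose u0 := Passage 0 true Over.
have [wU /allP wM _] := and3P wP.
pose h (d : dart w) : dart (reverse_word w) :=
  (cast_ord (congr1 S (esym sz)) (rev_ord d.1), ~~ d.2).
pose g (d : dart (reverse_word w)) : dart w :=
  (rev_ord (cast_ord (congr1 S sz) d.1), ~~ d.2).
apply: (@fcard_conj _ _ _ _ h); try exact: (@face_step_inj _ u0).
  exists g => -[k b]; rewrite /h /g /= negbK; congr (_, _).
    by apply/val_inj; rewrite /= !subSS subKn // -ltnS.
  by apply/val_inj; rewrite /= !subSS subKn // -ltnS -sz.
have mi k : (k < size w)%N ->
    mate_index (rev w) u0 (size w - k.+1) = (size w - (mate_index w u0 k).+1)%N.
  move=> lt_k; rewrite /mate_index nth_rev ?ltn_subrL ?(leq_ltn_trans _ lt_k) //.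
  by rewrite subnSK // subKn ?(ltnW lt_k) // index_rev // wM ?mem_nth.
have pred_rev k : (k < size w)%N -> (size w - k).-1 = (size w - k.+1)%N.
  by move=> lt_k; rewrite subnS.
have nr k : (k < size w)%N -> nth u0 (rev w) (size w - k.+1) = nth u0 w k.
  move=> lt_k; rewrite nth_rev ?ltn_subrL ?(leq_ltn_trans _ lt_k) //.
  by rewrite subnSK // subKn ?(ltnW lt_k).
case=> k []; rewrite [h (_, _)]/h /=.
  have [lt_k|ge_k] := ltnP k (size w); last first.
    have def_k : k = size w :> nat by apply/eqP; rewrite eqn_leq ge_k -ltnS ltn_ord.
    rewrite face_stepTn // [RHS]face_stepF0 //= ?def_k ?subSS ?subnn //.
  have lt_m := mate_index_lt u0 wP lt_k.
  rewrite (face_stepT u0) // [RHS](face_stepF u0) /= ?subSS ?subn_gt0 //.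
  rewrite pred_rev // /reverse_word nr // mi //; case: from_left.
    congr (_, _); apply/val_inj; rewrite /= !inordK //= ?size_rev ?ltnS ?leq_subr //.
  congr (_, _); apply/val_inj; rewrite /= !inordK //= ?size_rev ?ltnS ?subnSK ?leq_subr //.
  by rewrite ltnW.
have [def_k|k_gt0] := posnP k.
  rewrite face_stepF0 // [RHS]face_stepTn //= ?sz ?def_k ?subSS ?subn0 //.
have lt_k : (k.-1 < size w)%N by rewrite -ltnS prednK.
have lt_m := mate_index_lt u0 wP lt_k.
have E : (size w - k = size w - k.-1.+1)%N by rewrite prednK.
rewrite (face_stepF u0) // [RHS](face_stepT u0) /= ?sz ?subSS ?E; last first.
  by rewrite ltn_subrL (leq_ltn_trans _ lt_k).
rewrite /reverse_word nr // mi //; case: from_left.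
  congr (_, _); apply/val_inj; rewrite /= !inordK //= ?size_rev ?ltnS ?subnSK ?leq_subr //.
  by rewrite ltnW.
by congr (_, _); apply/val_inj; rewrite /= !inordK //= ?size_rev ?ltnS ?leq_subr.
Qed.

Lemma spherical_switch w : well_paired w ->
  spherical (switch_word w) = spherical w.
Proof.
move=> wP; have wP' : well_paired (switch_word w) by rewrite well_paired_switch.
have sz : size (switch_word w) = size w by rewrite size_map.
rewrite /spherical sz; congr (_ == _).
pose u0 := Passage 0 true Over.
pose h (d : dart w) : dart (switch_word w) :=
  (cast_ord (congr1 S (esym sz)) d.1, d.2).
pose g (d : dart (switch_word w)) : dart w :=
  (cast_ord (congr1 S sz) d.1, d.2).
apply: (@fcard_conj _ _ _ _ h); try exact: (@face_step_inj _ u0).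
  by exists g => -[k b]; rewrite /h /g /=; congr (_, _); apply/val_inj.
have lt u b : left_turn (switch_word w) (switch u) b = h (left_turn w u b).
  rewrite /left_turn mate_switch (index_map (inv_inj switchK)) /=.
  case: ifP => _; congr (_, _); apply/val_inj => /=.
  + have [lt_i|ge_i] := ltnP (index (mate u) w) (size w).
      by rewrite !inordK // ltnS ?sz.
    by rewrite /inord /insubd !insubN -?leqNgt ?ltnS ?sz.
  by rewrite !inordK // ltnS ?sz index_size.
case=> k []; rewrite /face_step /=.
  by rewrite /switch_word -map_drop; case: drop => [|u s] //=; rewrite -lt.
by rewrite /switch_word -map_take -map_rev; case: rev => [|u s] //=; rewrite -lt.
Qed.

Lemma reverse_paired (D : diagram) : well_paired (reverse_word D).
Proof. by rewrite well_paired_reverse word_paired. Qed.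
Lemma reverse_spherical (D : diagram) : spherical (reverse_word D).
Proof. by rewrite spherical_reverse ?word_paired ?word_spherical. Qed.
Definition reversal (D : diagram) : diagram :=
  Diagram (reverse_paired D) (reverse_spherical D).

Lemma switch_paired (D : diagram) : well_paired (switch_word D).
Proof. by rewrite well_paired_switch word_paired. Qed.
Lemma switch_spherical (D : diagram) : spherical (switch_word D).
Proof. by rewrite spherical_switch ?word_paired ?word_spherical. Qed.
Definition mirror (D : diagram) : diagram :=
  Diagram (switch_paired D) (switch_spherical D).

(* r(K) and m(K) are the virtual knotoids represented by r(D) and m(D), for   *)
(* any diagram D of K.                                                        *)
Definition invertible (K : virtual_knotoid) : Prop :=
  exists D : diagram, K D /\ K (reversal D).
Definition amphichiral (K : virtual_knotoid) : Prop :=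
  exists D : diagram, K D /\ K (mirror D).

(* A classical crossing is referred to by one of its two passages.            *)
Definition classical_crossings (w : seq passage) : seq passage :=
  [seq u <- w | level_of u == Over].

Definition left_passage (u : passage) := if from_left u then u else mate u.
Definition right_passage (u : passage) := if from_left u then mate u else u.
Definition left_pos (w : seq passage) (c : passage) := index (left_passage c) w.
Definition right_pos (w : seq passage) (c : passage) := index (right_passage c) w.

Definition sgn (c : passage) : int :=
  if level_of (left_passage c) == Over then 1 else - 1.

Definition label_step (u : passage) : int :=
  if classical u then (if from_left u then - 1 else 1) else 0.

Definition label (w : seq passage) (k : nat) : int :=
  \sum_(u <- take k w) label_step u.

Definition weight (w : seq passage) (c : passage) : int :=
  sgn c * (label w (left_pos w c) - (label w (right_pos w c) + 1)).

(* Smoothing c cuts off the closed loop between the two passages of c. The    *)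
(* left smoothed strand continues the incoming arc of the left passage by the *)
(* outgoing arc of the right one, so it is on the path from tail to head when *)
(* the left passage comes first, and on the loop otherwise. A component is    *)
(* given by the passages on it.                                               *)
Definition smoothing_loop (w : seq passage) (c : passage) : seq passage :=
  let i := minn (left_pos w c) (right_pos w c) in
  let j := maxn (left_pos w c) (right_pos w c) in
  drop i.+1 (take j w).
Definition smoothing_path (w : seq passage) (c : passage) : seq passage :=
  let i := minn (left_pos w c) (right_pos w c) in
  let j := maxn (left_pos w c) (right_pos w c) in
  take i w ++ drop j.+1 w.

Definition left_component (w : seq passage) (c : passage) : seq passage :=
  if (left_pos w c < right_pos w c)%N then smoothing_path w c
  else smoothing_loop w c.
Definition right_component (w : seq passage) (c : passage) : seq passage :=
  if (left_pos w c < right_pos w c)%N then smoothing_loop w c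
  else smoothing_path w c.

Definition component1 (w : seq passage) (c : passage) : seq passage :=
  if sgn c == 1 then left_component w c else right_component w c.
Definition component2 (w : seq passage) (c : passage) : seq passage :=
  if sgn c == 1 then right_component w c else left_component w c.

(* The classical crossings of the two components, each given by its passage   *)
(* on the first component.                                                    *)
Definition common_crossings (w : seq passage) (c : passage) : seq passage :=
  [seq u <- component1 w c | classical u && (mate u \in component2 w c)].

Definition crossing_number (w : seq passage) (c : passage) : nat :=
  size (common_crossings w c).

Definition ind (u : passage) : int :=
  if level_of u == Over then sgn u else - sgn u.

Definition intersection_index (w : seq passage) (c : passage) : int :=
  \sum_(u <- common_crossings w c) ind u.

Definition even_crossing (w : seq passage) (c : passage) : bool :=
  ~~ odd (crossing_number w c).
Definition odd_crossing (w : seq passage) (c : passage) : bool :=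
  odd (crossing_number w c).

(* The additive group of Z[x^{+-1}, y^{+-1}], as the free abelian group on    *)
(* the monomials x^a y^b, encoded by the pairs (a, b).                        *)
Notation laurent := {malg int[(int * int)%type]}.

Definition monomial (n a b : int) : laurent := << n *g (a, b) >>.

(* p(x^{-1}, y^{-1}) *)
Definition invert_variables (p : laurent) : laurent :=
  \sum_(m <- msupp p) monomial (mcoeff m p) (- m.1) (- m.2).

Definition knotoid_polynomial (w : seq passage) : laurent :=
  \sum_(c <- classical_crossings w | even_crossing w c)
     monomial (sgn c * intersection_index w c) (weight w c) 0
  + \sum_(c <- classical_crossings w | odd_crossing w c)
     monomial (sgn c * intersection_index w c) 0 (weight w c).

(* Main.v *)
Require Import Defs.
From mathcomp Require Import all_boot all_order all_algebra.
From mathcomp Require Import finmap monalg.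
From mathcomp Require Import zify.
Import GRing.Theory Num.Theory.
Local Open Scope ring_scope.

(** The polynomial depends on the signs and the weights of the crossings only.
At a classical passage the contribution [ind] to an intersection index is 1 if
the passage comes from the left and -1 otherwise, which is minus the change of
label there. Along a component of a smoothing, the self-crossings change the
label by 0 in total, so the intersection index i(c) is minus the total label
change along the first component. One of the two components is the closed loop
that joins the two passages of c, and the label changes along the two components
are opposite to each other; comparing with the labels at c gives i(c) = - W(c)
([intersection_indexE]). Being a sum of I(c) terms equal to 1 or -1, i(c) also
has the parity of I(c). The polynomial is therefore the sum over the crossings
of t(sgn c, W(c)), where t(s, n) is the monomial with coefficient - s n whose
exponent n is that of x if n is even and of y if n is odd
([knotoid_polynomialE]).

Reversing the orientation keeps the signs and negates the weights, because
labels are then counted from the head and change sign. Switching all crossings negates both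
the signs and the weights, because labels ignore the levels. Since t(s, n) is
odd in s and since t(- s, - n) is t(s, n) with the variables inverted, both
formulas for diagrams follow.

The statements on knotoids need the invariance of the polynomial under the
moves, which reduces to a comparison of labels. A first move creates a crossing
of weight 0, whose term vanishes; a second move creates two crossings of equal
weights and opposite signs, whose terms cancel; a virtual crossing changes no
label. In a third move, labels change only at the passages of the triangle, and
the condition that the three segments bound a triangle says exactly that the two
passages of each classical crossing are shifted by the same amount
([strand_shift_mate]), so that its weight is unchanged.

If a knotoid is both invertible and amphichiral, its polynomial is its own
opposite, and the group of Laurent polynomials has no torsion. *)

(** * Passages and their mates *)

Lemma mate_inj : injective mate.
Proof. exact: inv_inj mateK. Qed.

Lemma classical_mate u : classical (mate u) = classical u.
Proof. by case: u => c b []. Qed.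

Lemma label_step_mate u : label_step (mate u) = - label_step u.
Proof. by case: u => c [] []. Qed.

Lemma left_passage_mate u : left_passage (mate u) = left_passage u.
Proof. by rewrite /left_passage /=; case: (from_left u); rewrite //= mateK. Qed.

Lemma right_passage_mate u : right_passage (mate u) = right_passage u.
Proof. by rewrite /right_passage /=; case: (from_left u); rewrite //= mateK. Qed.

Lemma sgn_mate u : sgn (mate u) = sgn u.
Proof. by rewrite /sgn left_passage_mate. Qed.

Lemma weight_mate w u : weight w (mate u) = weight w u.
Proof.
by rewrite /weight /left_pos /right_pos sgn_mate left_passage_mate right_passage_mate.
Qed.

(** Whether the level or the direction at [u] is changed, [sgn u] changes; the
level cancels in [ind u], and only the direction is left. *)
Lemma ind_label_step u : classical u -> ind u = - label_step u.
Proof. by case: u => c [] []. Qed.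

Lemma well_paired_uniq w : well_paired w -> uniq w.
Proof. by case/and3P. Qed.

Lemma mem_mate w u : well_paired w -> (mate u \in w) = (u \in w).
Proof.
case/and3P=> _ /allP wM _; apply/idP/idP; last exact: wM.
by move/wM; rewrite mateK.
Qed.

Lemma mate_neq u : (mate u == u) = false.
Proof. by apply/eqP; case: u => c []. Qed.

Lemma perm_map_mate s : uniq s -> {in s, forall u, mate u \in s} ->
  perm_eq (map mate s) s.
Proof.
move=> sU sM; apply: uniq_perm => //; first by rewrite (map_inj_uniq mate_inj).
move=> u; rewrite -{1}(mateK u) (mem_map mate_inj).
by apply/idP/idP => /sM; rewrite ?mateK.
Qed.

(** * The intersection index is minus the weight *)

Definition label_sum (s : seq passage) : int := \sum_(u <- s) label_step u.

Lemma label_sum_cat s t : label_sum (s ++ t) = label_sum s + label_sum t.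
Proof. exact: big_cat. Qed.

Lemma label_sum_cons u s : label_sum (u :: s) = label_step u + label_sum s.
Proof. exact: big_cons. Qed.

Lemma label_sum_nil : label_sum [::] = 0.
Proof. exact: big_nil. Qed.

Definition label_sumE := (label_sum_nil, label_sum_cat, label_sum_cons).

Lemma label_sum_rev s : label_sum (rev s) = label_sum s.
Proof. by apply: perm_big; rewrite perm_rev. Qed.

(** The two passages of a crossing change the label in opposite ways. *)
Lemma label_sum_mate_closed s :
  uniq s -> {in s, forall u, mate u \in s} -> label_sum s = 0.
Proof.
move=> sU sM; have: label_sum s = - label_sum s.
  rewrite -{1}[label_sum s](perm_big _ (perm_map_mate _ sU sM)) /= big_map.
  by rewrite /label_sum -sumrN; apply: eq_bigr => u _; rewrite label_step_mate.
lia.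
Qed.

Lemma label_sum_well_paired w : well_paired w -> label_sum w = 0.
Proof.
move=> wP; apply: label_sum_mate_closed; first exact: well_paired_uniq.
by move=> u; rewrite mem_mate.
Qed.

(** The self-crossings of [A] have both passages in [A], so they contribute 0 to
the label sum of [A]; what remains are the crossings of [A] with [B]. Here [A]
and [B] stand for the two components of the smoothing at [c]. *)
Lemma sum_ind_common w c A B : well_paired w ->
    perm_eq w ([:: c; mate c] ++ A ++ B) ->
  \sum_(u <- [seq u <- A | classical u && (mate u \in B)]) ind u = - label_sum A.
Proof.
move=> wP wE; have wU := well_paired_uniq _ wP.
have: uniq ([:: c; mate c] ++ A ++ B) by rewrite -(perm_uniq wE).
rewrite 2!cat_uniq => /and3P[_ cAB /and3P[AU /hasPn AB _]].
have mateA u : u \in A -> (mate u \in B) = (mate u \notin A).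
  move=> uA; apply/idP/idP => [/AB //|mA].
  have: mate u \in w by rewrite mem_mate // (perm_mem wE) !mem_cat uA !orbT.
  rewrite (perm_mem wE) !mem_cat (negPf mA) /= !inE -orbA => /or3P[/eqP E|/eqP E|//].
    case/negP: cAB; apply/hasP; exists u; first by rewrite mem_cat uA.
    by rewrite /= !inE -E mateK eqxx orbT.
  case/negP: cAB; apply/hasP; exists u; first by rewrite mem_cat uA.
  by rewrite /= !inE (mate_inj _ _ E) eqxx.
(* [inner] is the contribution of the self-crossings of [A]. *)
have inner : label_sum [seq u <- A | mate u \in A] = 0.
  apply: label_sum_mate_closed; first exact: filter_uniq.
  by move=> u; rewrite !mem_filter mateK => /andP[-> ->].
have -> : label_sum A = label_sum [seq u <- A | mate u \notin A].
  rewrite -[RHS]add0r -inner /label_sum !big_filter.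
  by rewrite (bigID (fun u => mate u \in A)).
rewrite /label_sum !big_filter -sumrN big_seq_cond [RHS]big_seq_cond.
rewrite big_mkcond [RHS]big_mkcond; apply: eq_bigr => u _.
case uA: (u \in A) => //=; rewrite mateA //.
case: (boolP (classical u)) => [cu|/negPf vu] /=.
  by case: ifP => //; rewrite ind_label_step.
by rewrite /label_step vu oppr0 if_same.
Qed.

Lemma odd_size_sum_ind s : odd (size s) = odd (absz (\sum_(u <- s) ind u)).
Proof.
elim: s => [|u s IH]; first by rewrite big_nil.
rewrite big_cons /= IH; have: ind u = 1 \/ ind u = - 1.
  by rewrite /ind /sgn; do 2![case: ifP => _]; auto.
move: (\sum_(_ <- _) _) => m [] ->; lia.
Qed.

Lemma first_passage_split w c : well_paired w -> c \in w ->
  exists e a b d, (e = c \/ e = mate c) /\ w = a ++ e :: b ++ mate e :: d.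
Proof.
move=> wP cw; have [a [b wE]] : exists a b, w = a ++ c :: b.
  by case/splitPr: cw => a b; exists a, b.
have : mate c \in w by rewrite mem_mate.
rewrite wE mem_cat inE => /or3P[|/eqP|].
- case/splitPr => a1 a2; exists (mate c), a1, a2, b; split; first by right.
  by rewrite mateK -catA.
- by case: (c) => n [] l.
by case/splitPr => b1 b2; exists c, a, b1, b2; split; first by left.
Qed.

Lemma intersection_index_mate w c :
  intersection_index w (mate c) = intersection_index w c.
Proof.
by rewrite /intersection_index /common_crossings /component1 /component2
  /left_component /right_component /smoothing_loop /smoothing_path
  /left_pos /right_pos sgn_mate left_passage_mate right_passage_mate.
Qed.

(** The closed loop runs from just after the first passage of [c] to just before
the second, so its label sum is the difference of the labels of these arcs, which
is the weight up to sign. The label sum of the path is opposite to it, and the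
order of the components by the sign of [c] settles the sign. *)
Lemma intersection_indexE w c : well_paired w -> c \in w -> classical c ->
  intersection_index w c = - weight w c.
Proof.
move=> wP cw cc; have [e [a [b [d [ce wE]]]]] := first_passage_split _ _ wP cw.
(* Both sides are the same for the two passages of the crossing, so the crossing
   may be referred to by the passage [e] that comes first. *)
have [-> ->] : intersection_index w c = intersection_index w e /\ weight w c = weight w e.
  by case: ce => -> ; rewrite ?intersection_index_mate ?weight_mate.
have ec : classical e by case: ce => ->; rewrite ?classical_mate.
have := label_sum_well_paired _ wP; rewrite wE !label_sumE label_step_mate -wE => sum0.
have wU := well_paired_uniq _ wP.
have idx1 : index e w = size a.
  rewrite -[in LHS](_ : nth e w (size a) = e) ?index_uniq //.
    by rewrite wE size_cat /= -addSnnS leq_addr.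
  by rewrite wE nth_cat ltnn subnn.
have idx2 : index (mate e) w = (size a + (size b).+1)%N.
  rewrite -[in LHS](_ : nth e w (size a + (size b).+1) = mate e) ?index_uniq //.
    by rewrite wE size_cat /= size_cat /= -!addSnnS addnA leq_addr.
  by rewrite wE nth_cat ltnNge leq_addr addKn /= nth_cat ltnn subnn.
have take1 : take (size a) w = a by rewrite wE take_size_cat.
have take2 : take (size a + (size b).+1) w = a ++ e :: b.
  by rewrite wE -cat_cons catA take_size_cat // size_cat.
have drop2 : drop (size a + (size b).+1).+1 w = d.
  rewrite wE (_ : a ++ _ = rcons (a ++ e :: b) (mate e) ++ d).
    by rewrite drop_size_cat // size_rcons size_cat.
  by rewrite cat_rcons -catA.
have loopE : drop (size a).+1 (a ++ e :: b) = b.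
  by rewrite -cat_rcons drop_size_cat ?size_rcons.
have perm1 : perm_eq w ([:: e; mate e] ++ b ++ a ++ d).
  by rewrite wE; apply/permP => x; rewrite /= !count_cat /= !count_cat /=; lia.
have perm2 : perm_eq w ([:: e; mate e] ++ (a ++ d) ++ b).
  by rewrite (perm_trans perm1) // !perm_cat2l perm_catC.
have height1 : label w (size a) = label_sum a by rewrite /label take1.
have height2 : label w (size a + (size b).+1)%N
    = label_sum a + label_step e + label_sum b.
  by rewrite /label take2 -/(label_sum _) !label_sumE addrA.
have stepE : label_step e = if from_left e then - 1 else 1.
  by rewrite /label_step ec.
have lt12 : (size a < size a + (size b).+1)%N by rewrite -addSnnS leq_addr.
rewrite /intersection_index /common_crossings /weight /component1 /component2
  /left_component /right_component /smoothing_loop /smoothing_path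
  /left_pos /right_pos /left_passage /right_passage.
(* If [e] is the left passage, the path is the left component and the loop [b]
   the right one; otherwise they are exchanged. *)
case: ifP stepE => el stepE; rewrite !idx1 !idx2.
  rewrite lt12 (minn_idPl (ltnW lt12)) (maxn_idPr (ltnW lt12)).
  rewrite take1 take2 drop2 loopE height1 height2.
  case: eqP => [->|]; rewrite (sum_ind_common w e) //= ?label_sumE stepE.
    lia.
  rewrite /sgn; case: ifP => // _ _; lia.
rewrite ltnNge (ltnW lt12) /= (minn_idPr (ltnW lt12)) (maxn_idPl (ltnW lt12)).
rewrite take1 take2 drop2 loopE height1 height2.
case: eqP => [->|]; rewrite (sum_ind_common w e) //= ?label_sumE stepE.
  lia.
rewrite /sgn; case: ifP => // _ _; lia.
Qed.

Lemma odd_crossing_number w c : well_paired w -> c \in w -> classical c ->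
  odd (crossing_number w c) = odd (absz (weight w c)).
Proof.
move=> wP cw cc.
by rewrite odd_size_sum_ind -[\sum_(_ <- _) _]/(intersection_index w c)
  intersection_indexE // abszN.
Qed.

(** * The polynomial as a sum over signs and weights *)

(** The term sgn(c) i(c) z^W(c) of a crossing of sign [s] and weight [n], after
replacing i(c) by - W(c) and the parity of I(c) by that of W(c). *)
Definition crossing_term (s n : int) : laurent :=
  if odd (absz n) then monomial (- (s * n)) 0 n else monomial (- (s * n)) n 0.

(** Each classical crossing is met once whether it is referred to by its
overpassage or by its underpassage; the mirror image exchanges the two. *)
Definition crossing_sum (l : level) (w : seq passage) : laurent :=
  \sum_(u <- w | level_of u == l) crossing_term (sgn u) (weight w u).

Lemma knotoid_polynomialE w : well_paired w ->
  knotoid_polynomial w = crossing_sum Over w.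
Proof.
move=> wP; rewrite /knotoid_polynomial /classical_crossings !big_filter_cond.
rewrite /crossing_sum [RHS](bigID (fun u => ~~ odd (crossing_number w u))) /=.
congr (_ + _); rewrite big_seq_cond [RHS]big_seq_cond.
  apply: eq_big => u //; rewrite /even_crossing => /and3P[uw /eqP lu pu].
  have cu : classical u by rewrite /classical lu.
  rewrite intersection_indexE // mulrN /crossing_term.
  by rewrite -odd_crossing_number // (negPf pu).
apply: eq_big => u; first by rewrite negbK.
rewrite /odd_crossing => /and3P[uw /eqP lu pu].
have cu : classical u by rewrite /classical lu.
by rewrite intersection_indexE // mulrN /crossing_term -odd_crossing_number // pu.
Qed.

Lemma crossing_sum_Under w : well_paired w ->
  crossing_sum Under w = crossing_sum Over w.
Proof.
move=> wP; have wM : {in w, forall u, mate u \in w} by move=> u; rewrite mem_mate.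
rewrite /crossing_sum -[LHS](perm_big _ (perm_map_mate _ (well_paired_uniq _ wP) wM)).
rewrite /= big_map; apply: eq_big => [u|u _]; first by rewrite /=; case: (level_of u).
by rewrite sgn_mate weight_mate.
Qed.

(** * Inverting the variables *)

Lemma mcoeff_invert_variables p (k : int * int) :
  mcoeff k (invert_variables p) = mcoeff (- k.1, - k.2) p.
Proof.
have oppE (m : int * int) : ((- m.1, - m.2) == k) = (m == (- k.1, - k.2)).
  by apply/eqP/eqP => [<-|->] /=; rewrite !opprK -surjective_pairing.
rewrite /invert_variables raddf_sum /= [in RHS](monalgE p) raddf_sum /=.
by apply: eq_bigr => m _; rewrite !mcoeffU oppE.
Qed.

Lemma invert_variables0 : invert_variables 0 = 0.
Proof. by apply/malgP => k; rewrite mcoeff_invert_variables [LHS]mcoeff0 [RHS]mcoeff0. Qed.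

Lemma invert_variablesD p q :
  invert_variables (p + q) = invert_variables p + invert_variables q.
Proof.
apply/malgP => k; rewrite mcoeff_invert_variables.
rewrite (mcoeffD k (invert_variables p)).
rewrite (mcoeff_invert_variables p) (mcoeff_invert_variables q).
exact: mcoeffD.
Qed.

Lemma invert_monomial n a b :
  invert_variables (monomial n a b) = monomial n (- a) (- b).
Proof.
apply/malgP => k; rewrite mcoeff_invert_variables !mcoeffU; congr (_ *+ _).
by case: k => k1 k2; rewrite /= !xpair_eqE !eqr_oppLR.
Qed.

Lemma monomialN n a b : monomial (- n) a b = - monomial n a b.
Proof. exact: monalgUN. Qed.

Lemma invert_crossing_term s n :
  invert_variables (crossing_term s n) = crossing_term (- s) (- n).
Proof.
by rewrite /crossing_term abszN mulrNN; case: ifP => _; rewrite invert_monomial oppr0.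
Qed.

Lemma crossing_termN s n : crossing_term (- s) n = - crossing_term s n.
Proof. by rewrite /crossing_term mulNr; case: (odd _); exact: monomialN. Qed.

Lemma crossing_term0 s : crossing_term s 0 = 0.
Proof. by rewrite /crossing_term mulr0 oppr0 /monomial monalgU0. Qed.

Lemma invert_crossing_sum l w : invert_variables (crossing_sum l w) =
  \sum_(u <- w | level_of u == l) crossing_term (- sgn u) (- weight w u).
Proof.
rewrite (big_morph _ invert_variablesD invert_variables0).
by apply: eq_bigr => u _; rewrite invert_crossing_term.
Qed.

(** * Labels seen from a passage *)

(** The label of the arc that enters the passage [u]. Referring to arcs by
passages rather than by positions makes labels before and after a move
comparable. *)
Definition height (w : seq passage) (u : passage) : int := label w (index u w).

Lemma weightE w u : weight w u =
  sgn u * (height w (left_passage u) - (height w (right_passage u) + 1)).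
Proof. by []. Qed.

Lemma height_nil u : height [::] u = 0.
Proof. exact: label_sum_nil. Qed.

Lemma height_cons x w u :
  height (x :: w) u = if x == u then 0 else label_step x + height w u.
Proof.
rewrite /height /= /label; case: eqP => _; first by rewrite take0 big_nil.
by rewrite -/(label_sum _) label_sum_cons.
Qed.

Lemma height_cat s t u :
  height (s ++ t) u = if u \in s then height s u else label_sum s + height t u.
Proof.
elim: s => [|x s IH]; first by rewrite label_sum_nil add0r.
rewrite cat_cons !height_cons inE eq_sym IH label_sum_cons.
by case: eqP => //= _; case: ifP => //; rewrite addrA.
Qed.

Lemma height_split s t u : u \notin s -> height (s ++ u :: t) u = label_sum s.
Proof. by move=> us; rewrite height_cat (negPf us) height_cons eqxx addr0. Qed.

(** * Reversal and mirror image *)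

Lemma mem_left_passage w u : well_paired w -> (left_passage u \in w) = (u \in w).
Proof. by move=> wP; rewrite /left_passage; case: ifP; rewrite ?mem_mate. Qed.

Lemma mem_right_passage w u : well_paired w -> (right_passage u \in w) = (u \in w).
Proof. by move=> wP; rewrite /right_passage; case: ifP; rewrite ?mem_mate. Qed.

(** The arc entering [u] in the reversed word is the one leaving [u] in [w]; its
label is now counted from the head, and the label at the head of [w] is 0. *)
Lemma height_reverse w u : well_paired w -> u \in w ->
  height (reverse_word w) u = - (height w u + label_step u).
Proof.
move=> wP uw; have := well_paired_uniq _ wP; have := label_sum_well_paired _ wP.
case/splitPr: uw => a b; rewrite !label_sumE => sum0.
rewrite cat_uniq /= negb_or -!andbA => /and5P[_ ua _ ub _].
rewrite height_split // /reverse_word rev_cat rev_cons cat_rcons.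
rewrite height_split ?mem_rev // label_sum_rev; lia.
Qed.

Lemma label_step_left u : classical u -> label_step (left_passage u) = - 1.
Proof. by case: u => c [] []. Qed.

Lemma label_step_right u : classical u -> label_step (right_passage u) = 1.
Proof. by case: u => c [] []. Qed.

Lemma weight_reverse w u : well_paired w -> u \in w -> classical u ->
  weight (reverse_word w) u = - weight w u.
Proof.
move=> wP uw cu; rewrite !weightE -mulrN; congr (_ * _).
rewrite !height_reverse ?mem_left_passage ?mem_right_passage //.
by rewrite label_step_left // label_step_right //; lia.
Qed.

Lemma knotoid_polynomial_reverse w : well_paired w ->
  knotoid_polynomial (reverse_word w) = - invert_variables (knotoid_polynomial w).
Proof.
move=> wP; rewrite !knotoid_polynomialE ?well_paired_reverse //.
rewrite invert_crossing_sum -sumrN /crossing_sum.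
have wR : perm_eq (reverse_word w) w by rewrite perm_rev.
rewrite (perm_big _ wR) /= big_seq_cond [RHS]big_seq_cond.
apply: eq_bigr => u /andP[uw /eqP lu].
by rewrite crossing_termN opprK weight_reverse // /classical lu.
Qed.

Lemma left_passage_switch u : left_passage (switch u) = switch (left_passage u).
Proof. by case: u => c [] []. Qed.

Lemma right_passage_switch u : right_passage (switch u) = switch (right_passage u).
Proof. by case: u => c [] []. Qed.

Lemma sgn_switch u : classical u -> sgn (switch u) = - sgn u.
Proof. by case: u => c [] []. Qed.

Lemma height_map (f : passage -> passage) w u : injective f ->
  (forall v, label_step (f v) = label_step v) -> height (map f w) (f u) = height w u.
Proof.
move=> fI fs; elim: w => [|x w IH]; first by rewrite !height_nil.
by rewrite /= !height_cons (inj_eq fI) fs IH.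
Qed.

Lemma weight_switch w u : classical u ->
  weight (switch_word w) (switch u) = - weight w u.
Proof.
move=> cu; rewrite !weightE sgn_switch // mulNr left_passage_switch right_passage_switch.
rewrite /switch_word !height_map //; try exact: inv_inj switchK; by move=> [] ? [] [].
Qed.

Lemma knotoid_polynomial_switch w : well_paired w ->
  knotoid_polynomial (switch_word w) = invert_variables (knotoid_polynomial w).
Proof.
move=> wP; rewrite !knotoid_polynomialE ?well_paired_switch //.
rewrite -crossing_sum_Under ?well_paired_switch // invert_crossing_sum.
rewrite /crossing_sum big_map; apply: eq_big => u; first by rewrite /=; case: (level_of u).
move=> lu; have cu : classical u by case: u lu => c b [].
by rewrite sgn_switch ?weight_switch.
Qed.

(** * Moves that insert crossings *)

(** A form of the weight in which a passage and its mate play the same role: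
left and right no longer occur, only the level of [u] and the label change
at [u]. *)
Lemma weight_height w u : classical u -> weight w u =
  (if level_of u == Over then 1 else - 1)
  * (height w u - height w (mate u) + label_step u).
Proof.
rewrite weightE /sgn /left_passage /right_passage /label_step.
by case: u => c [] [] //= _; rewrite /mate /=; lia.
Qed.

Lemma sgn_label_step u : classical u ->
  sgn u = (if level_of u == Over then - 1 else 1) * label_step u.
Proof. by case: u => c [] []. Qed.

Lemma eq_weight w w' u : classical u ->
  height w' u - height w' (mate u) = height w u - height w (mate u) ->
  weight w' u = weight w u.
Proof. by move=> cu E; rewrite !weight_height // E. Qed.

Lemma height_insert s N t x : x \notin N -> label_sum N = 0 ->
  height (s ++ N ++ t) x = height (s ++ t) x.
Proof. by move=> xN N0; rewrite !height_cat (negPf xN) N0 add0r. Qed.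

(** The new word consists of the inserted passages [N] and of the old ones, which
keep their labels and hence their weights. *)
Lemma crossing_sum_insert N w w' : well_paired w -> uniq w' ->
    perm_eq w' (N ++ w) ->
    (forall u, u \notin N -> height w' u = height w u) ->
  crossing_sum Over w' =
    \sum_(u <- N | level_of u == Over) crossing_term (sgn u) (weight w' u)
    + crossing_sum Over w.
Proof.
move=> wP w'U w'E hE; rewrite /crossing_sum (perm_big _ w'E) big_cat /=.
congr (_ + _); rewrite big_seq_cond [RHS]big_seq_cond.
have: uniq (N ++ w) by rewrite -(perm_uniq w'E).
rewrite cat_uniq => /and3P[_ /hasPn Nw _].
apply: eq_bigr => u /andP[uw _].
by rewrite !weightE !hE // Nw ?mem_left_passage ?mem_right_passage.
Qed.

Lemma crossing_sum_rename f w : injective f ->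
  crossing_sum Over [seq Passage (f (crossing u)) (from_left u) (level_of u) | u <- w]
  = crossing_sum Over w.
Proof.
move=> fI; rewrite /crossing_sum big_map; apply: eq_bigr => u _.
set g := fun v => _.
have gI : injective g by case=> [c b l] [c' b' l'] [/fI -> -> ->].
have gL : left_passage (g u) = g (left_passage u) by rewrite /left_passage /=; case: ifP.
have gR : right_passage (g u) = g (right_passage u) by rewrite /right_passage /=; case: ifP.
have gS : sgn (g u) = sgn u by rewrite /sgn gL.
by rewrite !weightE -/(g u) gS gL gR !height_map.
Qed.

(** The passages [u] and [mate u] follow each other, so their labels differ by
the label change at [u] alone, which makes the weight of the new crossing 0. *)
Lemma crossing_sum_omega1 w0 w1 u :
    well_paired (w0 ++ w1) -> uniq (w0 ++ [:: u; mate u] ++ w1) ->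
  crossing_sum Over (w0 ++ [:: u; mate u] ++ w1) = crossing_sum Over (w0 ++ w1).
Proof.
move=> wP wU; have N0 : label_sum [:: u; mate u] = 0.
  by rewrite !label_sumE label_step_mate; lia.
rewrite (@crossing_sum_insert [:: u; mate u] (w0 ++ w1)) //; first last.
- by move=> x xN; rewrite height_insert.
- by rewrite perm_catCA.
have W0 : classical u -> weight (w0 ++ [:: u; mate u] ++ w1) u = 0.
  move=> cu; rewrite weight_height //.
  have := wU; rewrite cat_uniq /= !inE !negb_or -!andbA.
  case/and5P=> _ uw0 mw0 _ /andP[um _].
  rewrite !height_cat (negPf uw0) (negPf mw0) /= !height_cons !eqxx (negPf um).
  by rewrite (_ : _ + _ = 0) ?mulr0 //; lia.
rewrite !big_cons big_nil sgn_mate weight_mate.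
case lu: (level_of u); rewrite /= ?lu /= ?add0r ?addr0 //;
  by rewrite W0 ?crossing_term0 ?add0r // /classical lu.
Qed.

(** The new crossings have opposite signs, since [u] and [v] have the same level
and opposite directions. Their weights agree: going from [u] to [v] changes the
label by the same amount as going from [mate u] to [mate v], up to the label
changes at [u] and [v] themselves, in both orders of the second strand. *)
Lemma crossing_sum_omega2 w0 w1 w2 t u v :
    level_of u = level_of v -> from_left u = ~~ from_left v ->
    t = [:: mate u; mate v] \/ t = [:: mate v; mate u] ->
    well_paired (w0 ++ w1 ++ w2) -> uniq (w0 ++ [:: u; v] ++ w1 ++ t ++ w2) ->
  crossing_sum Over (w0 ++ [:: u; v] ++ w1 ++ t ++ w2)
  = crossing_sum Over (w0 ++ w1 ++ w2).
Proof.
move=> luv fuv tE wP wU.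
have suv : label_step v = - label_step u.
  by rewrite /label_step /classical luv fuv; case: ifP; case: (from_left v).
have N0 : label_sum [:: u; v] = 0 by rewrite !label_sumE suv; lia.
have t0 : label_sum t = 0.
  by case: tE => ->; rewrite !label_sumE !label_step_mate suv; lia.
rewrite (@crossing_sum_insert ([:: u; v] ++ t) (w0 ++ w1 ++ w2)) //; first last.
- move=> x; rewrite mem_cat negb_or => /andP[xN xt].
  by rewrite (height_insert w0) // !(catA w0 w1) (height_insert (w0 ++ w1)).
- by apply/permP => x; rewrite !count_cat; lia.
set w := w0 ++ _.
have Wv : classical u -> weight w v = weight w u.
  move=> cu; have cv : classical v by rewrite /classical -luv.
  rewrite !weight_height // luv suv; congr (_ * _).
  have := wU; rewrite cat_uniq => /and3P[_ /hasPn Nw0].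
  have notw0 x : x \in [:: u; v] ++ w1 ++ t ++ w2 -> (x \in w0) = false.
    by move=> xN; apply/negbTE/Nw0.
  have ut : mate u \in t by case: tE => ->; rewrite !inE eqxx ?orbT.
  have vt : mate v \in t by case: tE => ->; rewrite !inE eqxx ?orbT.
  rewrite catA cat_uniq => /and3P[uvw1 /hasPn Nt].
  have nott x : x \in t -> x \notin [:: u; v] ++ w1.
    by move=> xt; apply: Nt; rewrite mem_cat xt.
  rewrite cat_uniq => /and3P[tU _ _].
  have uv : (u == v) = false.
    by move: uvw1; rewrite /= !inE !negb_or; case: eqP.
  have hu : height w u = label_sum w0.
    by rewrite height_cat notw0 ?mem_head // height_cons eqxx addr0.
  have hv : height w v = label_sum w0 + label_step u.
    rewrite height_cat notw0 ?inE ?eqxx ?orbT //.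
    by rewrite height_cons uv height_cons eqxx addr0.
  have ht x : x \in t -> height w x = label_sum w0 + label_sum w1 + height t x.
    move=> xt; rewrite height_cat notw0 ?mem_cat ?xt ?orbT //.
    have := nott _ xt; rewrite mem_cat negb_or => /andP[/negPf xN /negPf xw1].
    by rewrite height_cat xN N0 add0r height_cat xw1 height_cat xt addrA.
  rewrite hu hv !ht //; case: tE tU => -> /=; rewrite !inE andbT => /negPf mm;
    rewrite !height_cons !eqxx mm label_step_mate ?suv; clear; lia.
have sv : classical u -> sgn v = - sgn u.
  move=> cu; have cv : classical v by rewrite /classical -luv.
  by rewrite !sgn_label_step // luv suv mulrN.
have tt : perm_eq t [:: mate u; mate v].
  by case: tE => -> //; exact: (permEl (perm_catC [:: mate v] [:: mate u])).
rewrite big_cat /= (perm_big _ tt) /= !big_cons !big_nil !sgn_mate !weight_mate /= -luv.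
case lu: (level_of u); rewrite /= ?add0r ?addr0 //;
  rewrite Wv ?sv ?crossing_termN ?subrr ?add0r // /classical lu //.
Qed.

Lemma crossing_sum_virtual N w w' : well_paired w -> uniq w' ->
    perm_eq w' (N ++ w) -> (forall u, u \in N -> level_of u = Virtual) ->
    (forall u, u \notin N -> height w' u = height w u) ->
  crossing_sum Over w' = crossing_sum Over w.
Proof.
move=> wP w'U w'E Nv hE; rewrite (@crossing_sum_insert N w) //.
rewrite big_seq_cond big1 ?add0r // => u /andP[/Nv ->] //.
Qed.

Lemma label_step_virtual u : level_of u = Virtual -> label_step u = 0.
Proof. by rewrite /label_step /classical => ->. Qed.

Lemma crossing_sum_omegaV_tail w0 w1 u : level_of u = Virtual ->
    well_paired (w0 ++ w1) -> uniq (u :: w0 ++ mate u :: w1) ->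
  crossing_sum Over (u :: w0 ++ mate u :: w1) = crossing_sum Over (w0 ++ w1).
Proof.
move=> vu wP wU; have vm : level_of (mate u) = Virtual by rewrite /= vu.
apply: (@crossing_sum_virtual [:: u; mate u]) => //.
- by apply/permP => x; rewrite /= !count_cat /=; lia.
- by move=> x; rewrite !inE => /orP[] /eqP ->.
move=> x; rewrite !inE negb_or => /andP[xu xm].
rewrite height_cons eq_sym (negPf xu) label_step_virtual // add0r.
by rewrite (height_insert w0 [:: mate u]) ?inE // !label_sumE label_step_virtual.
Qed.

Lemma crossing_sum_omegaV_head w0 w1 u : level_of u = Virtual ->
    well_paired (w0 ++ w1) -> uniq (w0 ++ u :: w1 ++ [:: mate u]) ->
  crossing_sum Over (w0 ++ u :: w1 ++ [:: mate u]) = crossing_sum Over (w0 ++ w1).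
Proof.
move=> vu wP wU; have vm : level_of (mate u) = Virtual by rewrite /= vu.
apply: (@crossing_sum_virtual [:: u; mate u]) => //.
- by apply/permP => x; rewrite /= !count_cat /= !count_cat /=; lia.
- by move=> x; rewrite !inE => /orP[] /eqP ->.
move=> x; rewrite !inE negb_or => /andP[xu xm].
rewrite (height_insert w0 [:: u]) ?inE ?label_sumE ?label_step_virtual //.
have := height_insert (w0 ++ w1) [:: mate u] [::] x.
by rewrite !cats0 -catA inE !label_sumE label_step_virtual //; apply.
Qed.

(** * The third Reidemeister move *)

(** The change of the label at [u] when the two successive passages of the strand
[p] are exchanged: each of them moves across the other one. *)
Definition swap_shift (p : passage * passage) (u : passage) : int :=
  if u == p.1 then label_step p.2 else if u == p.2 then - label_step p.1 else 0.

Lemma height_swap s p t u : uniq (s ++ [:: p.1; p.2] ++ t) ->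
  height (s ++ [:: p.2; p.1] ++ t) u = height (s ++ [:: p.1; p.2] ++ t) u + swap_shift p u.
Proof.
case: p => a b /=; rewrite cat_uniq => /and3P[_ /hasPn abs].
rewrite /= inE negb_or => /andP[/andP[/negPf ab _] _].
rewrite !height_cat /= !height_cons /swap_shift /= [a == u]eq_sym [b == u]eq_sym.
have [->|ua] := eqVneq u a.
  by rewrite (negPf (abs a _)) ?ab ?mem_head //; lia.
have [->|ub] := eqVneq u b.
  by rewrite (negPf (abs b _)) ?inE ?eqxx ?orbT //; lia.
by case: ifP => _; lia.
Qed.

(** The two passages of one strand, in either order. *)
Definition companions (s : seq (passage * passage)) (u x : passage) : bool :=
  ((u, x) \in s) || ((x, u) \in s).

Lemma companionsC s u x : companions s u x = companions s x u.
Proof. exact: orbC. Qed.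

Lemma strand_passages_companion s u :
  u \in strand_passages s -> exists x, companions s u x.
Proof.
rewrite mem_cat => /orP[] /mapP[[a b] abs ->]; first by exists b; rewrite /companions abs.
by exists a; rewrite /companions abs orbT.
Qed.

Lemma companions_mem s u x : companions s u x -> u \in strand_passages s.
Proof.
rewrite mem_cat => /orP[] us; apply/orP; [left | right].
  exact: (map_f fst us).
exact: (map_f snd us).
Qed.

Lemma companions_first s u x : uniq (strand_passages s) -> companions s u x ->
  (x \in first_passages s) = (u \notin first_passages s).
Proof.
rewrite cat_uniq => /and3P[_ /hasPn s12 _]; rewrite /companions => /orP[] us.
  have -> : u \in first_passages s by exact: (map_f fst us).
  by apply/negbTE/s12; exact: (map_f snd us).
have -> : x \in first_passages s by exact: (map_f fst us).
by symmetry; apply: s12; exact: (map_f snd us).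
Qed.

Definition strand_shift (s : seq (passage * passage)) (u : passage) : int :=
  \sum_(p <- s) swap_shift p u.

Lemma strand_shift_notin s u : u \notin strand_passages s -> strand_shift s u = 0.
Proof.
rewrite mem_cat negb_or => /andP[u1 u2].
rewrite /strand_shift big_seq big1 // => p ps; rewrite /swap_shift.
case: eqP => [E|_]; first by rewrite E (map_f fst ps) in u1.
by case: eqP => [E|//]; rewrite E (map_f snd ps) in u2.
Qed.

Lemma perm_strand_passages s s' : perm_eq s s' ->
  perm_eq (strand_passages s) (strand_passages s').
Proof. by move=> E; apply: perm_cat; apply: perm_map. Qed.

Lemma perm_strand_passages_cons p s :
  perm_eq (strand_passages (p :: s)) (p.1 :: p.2 :: strand_passages s).
Proof. by apply/permP => a; rewrite /strand_passages /= !count_cat /=; lia. Qed.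

Lemma strand_shiftE s u x : uniq (strand_passages s) -> companions s u x ->
  strand_shift s u =
  if u \in first_passages s then label_step x else - label_step x.
Proof.
move=> sU ux; have := companions_first _ _ _ sU ux.
have [p ps pE] : exists2 p, p \in s & p = (u, x) \/ p = (x, u).
  by case/orP: ux => us; [exists (u, x) | exists (x, u)]; auto.
have sE := perm_to_rem ps.
move: sU; rewrite (perm_uniq (perm_strand_passages _ _ sE)).
rewrite (perm_uniq (perm_strand_passages_cons _ _)) /= inE negb_or -andbA.
case/and4P=> p12 p1s p2s _.
rewrite /strand_shift (perm_big _ sE) big_cons -/(strand_shift _ _).
case: pE => pE; rewrite pE /= in p12 p1s p2s ps *.
  by rewrite (map_f fst ps) strand_shift_notin // /swap_shift eqxx addr0.
rewrite (map_f fst ps) => /esym /negPf ->.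
by rewrite strand_shift_notin // /swap_shift eq_sym (negPf p12) eqxx addr0.
Qed.

(** Three strands with passages u, x; mate u, y; z1, z2: as u is paired with
mate u, the passages z1 and z2 can only be paired with x and y. *)
Lemma triangle_third u x y z1 z2 :
    uniq [:: u; x; mate u; y; z1; z2] ->
    mate z1 \in [:: u; x; mate u; y; z1; z2] ->
    mate z2 \in [:: u; x; mate u; y; z1; z2] -> mate z1 != z2 ->
  (mate x = z1 /\ mate y = z2) \/ (mate x = z2 /\ mate y = z1).
Proof.
move=> U m1 m2 n12.
have on_xy z : z \in [:: z1; z2] -> mate z \in [:: u; x; mate u; y; z1; z2] ->
    mate z \in [:: x; y].
  move=> zE; have : z \notin [:: u; x; mate u; y].
    move: U; rewrite (cat_uniq [:: _; _; _; _] [:: z1; z2]).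
    by case/and3P=> _ /hasPn zs _; apply: zs.
  have zz := mate_neq z.
  have z12 : mate z \notin [:: z1; z2].
    move: zE; rewrite !inE => /orP[] /eqP E; rewrite E in zz *; rewrite zz ?orbF //.
    by rewrite (inv_eq mateK) eq_sym.
  rewrite !inE !negb_or in z12 * => /and4P[zu _ zm _].
  rewrite (inv_eq mateK) (inj_eq mate_inj) (negPf zu) (negPf zm) /=.
  by case/andP: z12 => /negPf -> /negPf ->; rewrite !orbF.
have {}m1 : mate z1 \in [:: x; y] by apply: on_xy m1; rewrite mem_head.
have {}m2 : mate z2 \in [:: x; y] by apply: on_xy m2; rewrite !inE eqxx orbT.
rewrite !inE in m1 m2.
have nz : z1 != z2.
  by move: U; rewrite /= !inE !negb_or -!andbA => /and5P[_ _ _ _] /and5P[_ _ _ _] /and5P[_ _ _ _] /and4P[].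
move: m1 m2 nz => /orP[] /eqP E1 /orP[] /eqP E2; rewrite -?E1 -?E2 ?mateK; auto;
  by rewrite -[z1]mateK E1 -E2 mateK eqxx.
Qed.

(** The strands through the crossing [u] meet the third strand at the companions
[x] of [u] and [y] of [mate u]; the last conjunct says that there is no other
strand than these three. *)
Lemma companion_of_mate s u : size s = 3 -> uniq (strand_passages s) ->
    pairwise_crossing s -> u \in strand_passages s ->
  exists x y, [/\ companions s u x, companions s (mate u) y,
                  companions s (mate x) (mate y)
                & forall p, p \in s -> [\/ u \in [:: p.1; p.2], mate u \in [:: p.1; p.2]
                    | {subset [:: mate x; mate y] <= [:: p.1; p.2]}]].
Proof.
move=> s3 sU /andP[/allP sM /allP sN] us.
have [x ux] := strand_passages_companion _ _ us.
have [y vy] := strand_passages_companion _ _ (sM _ us).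
exists x, y; suff [xy third] : companions s (mate x) (mate y) /\
    forall p, p \in s -> [\/ u \in [:: p.1; p.2], mate u \in [:: p.1; p.2]
      | {subset [:: mate x; mate y] <= [:: p.1; p.2]}] by [].
have [p ps pE] : exists2 p, p \in s & p = (u, x) \/ p = (x, u).
  by case/orP: ux => h; [exists (u, x) | exists (x, u)]; auto.
have [q qs qE] : exists2 q, q \in s & q = (mate u, y) \/ q = (y, mate u).
  by case/orP: vy => h; [exists (mate u, y) | exists (y, mate u)]; auto.
have mu := mate_neq u.
have pq : q != p.
  apply/eqP=> qp; have := sN _ ps; case: pE qp qE => -> -> [] [] /= E1 E2.
  - by rewrite -E1 eqxx in mu.
  - by rewrite E2 eqxx.
  - by rewrite E1 mateK eqxx.
  - by rewrite -E2 eqxx in mu.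
have sU1 : uniq s by move: sU; rewrite cat_uniq => /andP[/map_uniq].
have qs' : q \in rem p s by rewrite mem_rem_uniq // !inE pq.
have : size (rem q (rem p s)) = 1 by rewrite !size_rem // s3.
case E: (rem q (rem p s)) => [|r []] // _.
have sE : perm_eq s [:: p; q; r].
  by apply: perm_trans (perm_to_rem ps) _; rewrite perm_cons -E perm_to_rem.
have rs : r \in s by rewrite (perm_mem sE) !inE eqxx !orbT.
have spE : perm_eq (strand_passages s) [:: u; x; mate u; y; r.1; r.2].
  apply: perm_trans (perm_strand_passages _ _ sE) _.
  by clear - pE qE; apply/permP => a; case: pE qE => -> [] -> /=; lia.
have mE : strand_passages s =i [:: u; x; mate u; y; r.1; r.2] := perm_mem spE.
have r1 : r.1 \in strand_passages s by rewrite mem_cat map_f.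
have r2 : r.2 \in strand_passages s by rewrite mem_cat orbC map_f.
have xy : (mate x = r.1 /\ mate y = r.2) \/ (mate x = r.2 /\ mate y = r.1).
  apply: (triangle_third u); rewrite -?mE; [|exact: sM|exact: sM|exact: sN].
  by rewrite -(perm_uniq spE).
split=> [|p'].
  by rewrite /companions; case: xy => -[-> ->]; rewrite -surjective_pairing rs ?orbT.
rewrite (perm_mem sE) !inE => /or3P[] /eqP ->.
- by apply: Or31; case: pE => ->; rewrite /= eqxx ?orbT.
- by apply: Or32; case: qE => ->; rewrite /= eqxx ?orbT.
by apply: Or33; case: xy => -[-> ->] z //; rewrite !inE orbC.
Qed.

Lemma triangle_on_left s u x : triangle s -> companions s u x ->
  on_left s u = on_left s x.
Proof. by case/andP=> _ /allP sL /orP[] /sL /eqP. Qed.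

(** With x, y the companions of u and mate u, the shifts at u and mate u are the
label changes at x and y, with signs given by the order of u, x and of mate u, y.
Either both changes are 0 or x and y are classical. In the latter case,
write F(z) when z is first on its strand and L(z) when it comes from the left,
and + for exclusive or. As mate x and mate y are companions, the equality of
sides on the strand of u reads F(mate u) + L(u) = F(mate x) + L(x), and on the
strand of mate u it reads F(u) + not L(u) = not F(mate x) + L(y). Adding the two
gives L(x) + F(u) = L(y) + F(mate u), which is the equality of the signs. *)
Lemma strand_shift_mate s u : size s = 3 -> uniq (strand_passages s) ->
    triangle s ->
    [|| omega3_classical s, omega3_virtual s | omega3_mixed s] ->
    classical u -> u \in strand_passages s ->
  strand_shift s (mate u) = strand_shift s u.
Proof.
move=> s3 sU sT sK cu us; have [sC _] := andP sT.
have [x [y [ux vy mxy cover]]] := companion_of_mate _ _ s3 sU sC us.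
(* In a mixed move the virtual strand avoids the classical crossing [u], so it is
   the third strand and meets the two others at [x] and [y]. *)
have cxy : classical x = classical y.
  case/or3P: sK => [/andP[/allP all_cl _]|/allP all_virt|/andP[/hasP[p ps /andP[p1 p2]] _]].
  - have xs := companions_mem s x u; have ys := companions_mem s y (mate u).
    by rewrite !all_cl ?xs ?ys // companionsC.
  - have := cu; rewrite /classical.
    by case/orP: ux => /all_virt /andP[/= lv lv']; rewrite ?lv ?lv'.
  have pv z : z \in [:: p.1; p.2] -> ~~ classical z.
    by rewrite negbK !inE => /orP[] /eqP ->.
  case: (cover _ ps) => [/pv|/pv|xyp]; rewrite ?classical_mate ?cu //.
  have := pv _ (xyp _ (mem_head _ _)); rewrite classical_mate => /negPf ->.
  have : mate y \in [:: p.1; p.2] by apply: xyp; rewrite !inE eqxx orbT.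
  by move/pv; rewrite classical_mate => /negPf ->.
rewrite (strand_shiftE _ _ _ sU ux) (strand_shiftE _ _ _ sU vy).
have := triangle_on_left _ _ _ sT ux; have := triangle_on_left _ _ _ sT vy.
rewrite /on_left mateK /= (companions_first _ _ _ sU mxy) /label_step cxy.
by case: (classical y); case: (u \in _); case: (mate u \in _);
  case: (mate x \in _); case: (from_left u); case: (from_left x); case: (from_left y).
Qed.

Lemma crossing_sum_omega3 w0 w1 w2 w3 p q r (s := [:: p; q; r])
    (w := w0 ++ [:: p.1; p.2] ++ w1 ++ [:: q.1; q.2] ++ w2 ++ [:: r.1; r.2] ++ w3)
    (w' := w0 ++ [:: p.2; p.1] ++ w1 ++ [:: q.2; q.1] ++ w2 ++ [:: r.2; r.1] ++ w3) :
    triangle s -> [|| omega3_classical s, omega3_virtual s | omega3_mixed s] ->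
    uniq w -> crossing_sum Over w' = crossing_sum Over w.
Proof.
move=> sT sK wU; have w'w : perm_eq w' w.
  by apply/permP => a; rewrite !count_cat /=; clear; lia.
have sU : uniq (strand_passages s).
  have : uniq (strand_passages s ++ w0 ++ w1 ++ w2 ++ w3).
    rewrite (_ : uniq _ = uniq w) //; apply/perm_uniq/permP => a.
    by rewrite !count_cat /=; clear; lia.
  by rewrite cat_uniq => /and3P[].
have hE u : height w' u = height w u + strand_shift s u.
  rewrite /strand_shift !big_cons big_nil addr0 !addrA.
  (* The three strands are exchanged one at a time. *)
  pose wp := w0 ++ [:: p.2; p.1] ++ w1 ++ [:: q.1; q.2] ++ w2 ++ [:: r.1; r.2] ++ w3.
  pose wpq := w0 ++ [:: p.2; p.1] ++ w1 ++ [:: q.2; q.1] ++ w2 ++ [:: r.1; r.2] ++ w3.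
  have wpU : uniq wp.
    rewrite (_ : uniq _ = uniq w) //; apply/perm_uniq/permP => a.
    by rewrite !count_cat /=; clear; lia.
  have wpqU : uniq wpq.
    rewrite (_ : uniq _ = uniq w) //; apply/perm_uniq/permP => a.
    by rewrite !count_cat /=; clear; lia.
  have E1 := height_swap w0 p (w1 ++ [:: q.1; q.2] ++ w2 ++ [:: r.1; r.2] ++ w3) u wU.
  have := height_swap (w0 ++ [:: p.2; p.1] ++ w1) q (w2 ++ [:: r.1; r.2] ++ w3) u.
  have := height_swap (w0 ++ [:: p.2; p.1] ++ w1 ++ [:: q.2; q.1] ++ w2) r w3 u.
  by rewrite -!catA => /(_ wpqU) E3 /(_ wpU) E2; rewrite /w' E3 E2 E1.
rewrite /crossing_sum (perm_big _ w'w) /=; apply: eq_bigr => u /eqP lu.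
have cu : classical u by rewrite /classical lu.
congr (crossing_term _ _); apply: eq_weight => //; rewrite !hE.
suff -> : strand_shift s (mate u) = strand_shift s u by rewrite opprD addrACA subrr addr0.
have [us|us] := boolP (u \in strand_passages s); first exact: strand_shift_mate.
rewrite !strand_shift_notin //; apply: contra us => ms.
by case/andP: sT => /andP[/allP sM _] _; rewrite -(mateK u); apply: sM.
Qed.

(** * Invariance of the polynomial *)

Lemma knotoid_polynomial_move w w' : move w w' ->
  well_paired w -> well_paired w' -> knotoid_polynomial w = knotoid_polynomial w'.
Proof.
move=> ww' wP wP'; rewrite !knotoid_polynomialE //.
have wU := well_paired_uniq _ wP; have wU' := well_paired_uniq _ wP'.
case: ww' wP wP' wU wU' => [f {}w fI|w0 w1 u|w0 w1 w2 t u v luv fuv tE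
    |w0 w1 w2 w3 p q r sT sK|w0 w1 u vu|w0 w1 u vu] wP wP' wU wU'; symmetry.
- exact: crossing_sum_rename.
- exact: crossing_sum_omega1.
- exact: crossing_sum_omega2.
- exact: crossing_sum_omega3.
- exact: crossing_sum_omegaV_tail.
exact: crossing_sum_omegaV_head.
Qed.

Lemma knotoid_polynomial_equivalent D D' : equivalent D D' ->
  knotoid_polynomial D = knotoid_polynomial D'.
Proof.
elim=> [D1 D2 D12|//|D1 D2 _ -> //|D1 D2 D3 _ -> _ -> //].
by apply: knotoid_polynomial_move; rewrite ?word_paired.
Qed.

Lemma knotoid_polynomial_invariant (K : virtual_knotoid) D D' : K D -> K D' ->
  knotoid_polynomial D = knotoid_polynomial D'.
Proof.
case: (knotoid_class K) => D0 KE /KE D0D /KE D0D'.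
by rewrite -(knotoid_polynomial_equivalent _ _ D0D) (knotoid_polynomial_equivalent _ _ D0D').
Qed.

Theorem proposition3p1 (K : virtual_knotoid) (D : diagram) (hD : has_diagram K D) :
  (knotoid_polynomial (reversal D) = - invert_variables (knotoid_polynomial D) /\
   (invertible K ->
    knotoid_polynomial D = - invert_variables (knotoid_polynomial D))) /\
  (knotoid_polynomial (mirror D) = invert_variables (knotoid_polynomial D) /\
   (amphichiral K ->
    knotoid_polynomial D = invert_variables (knotoid_polynomial D))) /\
  (invertible K -> amphichiral K -> knotoid_polynomial D = 0).
Proof.
have rE (D' : diagram) : knotoid_polynomial (reversal D')
    = - invert_variables (knotoid_polynomial D').
  by apply: knotoid_polynomial_reverse; apply: word_paired.
have mE (D' : diagram) : knotoid_polynomial (mirror D')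
    = invert_variables (knotoid_polynomial D').
  by apply: knotoid_polynomial_switch; apply: word_paired.
have inv : invertible K ->
    knotoid_polynomial D = - invert_variables (knotoid_polynomial D).
  case=> D' [KD' KrD']; rewrite (knotoid_polynomial_invariant _ _ _ hD KD') -rE.
  exact: (knotoid_polynomial_invariant _ _ _ KD' KrD').
have amp : amphichiral K ->
    knotoid_polynomial D = invert_variables (knotoid_polynomial D).
  case=> D' [KD' KmD']; rewrite (knotoid_polynomial_invariant _ _ _ hD KD') -mE.
  exact: (knotoid_polynomial_invariant _ _ _ KD' KmD').
split; first by split; [exact: rE | exact: inv].
split; first by split; [exact: mE | exact: amp].
move=> /inv P1 /amp P2; apply/malgP => k; rewrite mcoeff0.
have: mcoeff k (knotoid_polynomial D) = - mcoeff k (knotoid_polynomial D).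
  by rewrite {1}P1 -P2 mcoeffN.
by set n := mcoeff _ _; lia.
Qed.
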